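(* For every $n\ge 5$ and every $k$ with $1\le k\le n-2$, there exists a (strongly connected) tournament $T_{n,k}$ on $n$ vertices such that $\overrightarrow{rvc}(T_{n,k})=\overrightarrow{srvc}(T_{n,k})=k$.
   Context: A tournament is a digraph in which every two distinct vertices are joined by exactly one arc (in one direction). A (directed) path is a sequence of distinct vertices $x_0,\dots,x_\ell$ with each $x_{i-1}x_i$ an arc; its length is $\ell$. A digraph is strongly connected if for every ordered pair $(u,v)$ there is a $u$–$v$ path; a $u$–$v$ geodesic is a shortest $u$–$v$ path. In a vertex-coloured digraph, a path is rainbow if its internal vertices have pairwise distinct colours. A vertex-colouring of a strongly connected digraph $D$ is rainbow vertex-connected if every ordered pair $(u,v)$ is joined by a rainbow $u$–$v$ path, and strongly rainbow vertex-connected if every ordered pair is joined by a rainbow $u$–$v$ geodesic. $\overrightarrow{rvc}(D)$ (resp. $\overrightarrow{srvc}(D)$) is the minimum number of colours in a rainbow vertex-connected (resp. strongly rainbow vertex-connected) vertex-colouring of $D$. *)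

(* Defs.v *)
From mathcomp Require Import all_boot.

Set Implicit Arguments.
Unset Strict Implicit.
Unset Printing Implicit Defensive.

(* A digraph on the vertex set V is given by its arc relation e. *)
Section Digraph.

Variables (V : finType) (e : rel V).

Definition tournament : Prop :=
  irreflexive e /\ forall x y : V, x != y -> e x y (+) e y x.

(* The sequence u :: p is a path from u to v; its length is size p.  The
   one-vertex path is the case u = v, p = [::]. *)
Definition dipath (u v : V) (p : seq V) : bool :=
  [&& path e u p, last u p == v & uniq (u :: p)].

Definition strongly_connected : Prop :=
  forall u v : V, exists p : seq V, dipath u v p.

Definition geodesic (u v : V) (p : seq V) : Prop :=
  dipath u v p /\ forall q : seq V, dipath u v q -> size p <= size q.

(* The vertices of u :: p other than the first and the last. *)
Definition internal (u : V) (p : seq V) : seq V := behead (belast u p).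

Definition rainbow (c : V -> nat) (u : V) (p : seq V) : bool :=
  uniq [seq c x | x <- internal u p].

Definition rainbow_vertex_connected (c : V -> nat) : Prop :=
  forall u v : V, exists p : seq V, dipath u v p /\ rainbow c u p.

Definition strongly_rainbow_vertex_connected (c : V -> nat) : Prop :=
  forall u v : V, exists p : seq V, geodesic u v p /\ rainbow c u p.

(* Colours are natural numbers; only those actually used are counted. *)
Definition num_colours (c : V -> nat) : nat := size (undup (codom c)).

Definition min_colours (P : (V -> nat) -> Prop) (k : nat) : Prop :=
  (exists2 c : V -> nat, P c & num_colours c = k) /\
  (forall c : V -> nat, P c -> k <= num_colours c).

(* The parameters rvc and srvc are minima over colourings which exist only for
   strongly connected digraphs, so "rvc = k" and "srvc = k" are stated as
   relations (functional in k) instead of using a default value. *)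
Definition rvc_eq (k : nat) : Prop := min_colours rainbow_vertex_connected k.

Definition srvc_eq (k : nat) : Prop :=
  min_colours strongly_rainbow_vertex_connected k.

End Digraph.

(* Main.v *)
(* A tournament of diameter 2 settles [k = 1]; from one on a vertex set [A] we get
   one with two more vertices [x], [y] by adding all arcs [A -> x -> y -> A].  For [k >= 2], split the vertices
   into levels [0, ..., k + 1], all levels but the first being singletons; arcs
   go up by exactly one level, down by at least two levels, and level [0] is
   transitive.  Going from level [0] to level [k + 1] then takes [k + 1] steps,
   so [k] colours are necessary; colouring the levels [1, ..., k] differently
   suffices because geodesics either climb through consecutive levels, have
   length at most 2, or have length 3 with internal vertices in levels 1 and 2. *)
Require Import Defs.
From mathcomp Require Import all_boot.
From mathcomp Require Import zify.

(** * Short geodesics and colour counts *)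

Section Digraphs.

Variables (V : finType) (e : rel V).

(** A path of length at most 2 has at most one internal vertex, so it is rainbow for every
    colouring. *)
Lemma geodesic_short (c : V -> nat) (u v : V) :
  irreflexive e -> [\/ u = v, e u v | exists2 w, e u w & e w v] ->
  exists p, geodesic e u v p /\ rainbow c u p.
Proof.
move=> irr; have neq x y : e x y -> x != y.
  by move=> exy; apply/eqP => xy; rewrite xy irr in exy.
have [<- _|nuv] := eqVneq u v.
  by exists [::]; split=> //; split=> //; rewrite /dipath /= eqxx.
have size_gt0 q : dipath e u v q -> 0 < size q.
  by case: q => // /and3P[_ /= uv]; rewrite (negPf nuv) in uv.
have [euv _|nuvE] := boolP (e u v).
  exists [:: v]; split=> //; split=> //.
  by rewrite /dipath /= euv eqxx inE nuv.
case=> [uv||[w euw ewv]]; [by rewrite uv eqxx in nuv | by []|].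
exists [:: w; v]; split=> //; split.
  by rewrite /dipath /= euw ewv eqxx !inE negb_or nuv (neq u w) // neq.
move=> q pq; have := size_gt0 _ pq; case: q pq => [|a [|b q]] //= + _.
by case/and3P=> /= /andP[eua _] /eqP av; rewrite -av eua in nuvE.
Qed.

Lemma num_colours_le (c : V -> nat) (k : nat) :
  (forall x, c x < k) -> num_colours c <= k.
Proof.
move=> ltck; rewrite -[leqRHS](size_iota 0); apply: uniq_leq_size.
  exact: undup_uniq.
by move=> i; rewrite mem_undup mem_iota => /codomP[x ->]; apply: ltck.
Qed.

Lemma rainbow_num_colours (c : V -> nat) (u : V) (p : seq V) :
  rainbow c u p -> (size p).-1 <= num_colours c.
Proof.
move=> rp; have -> : (size p).-1 = size [seq c x | x <- internal u p].
  by rewrite size_map size_behead size_belast.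
apply: uniq_leq_size => // i /mapP[x _ ->].
by rewrite mem_undup codom_f.
Qed.

(** Geodesics are paths, so a lower bound for the weak notion also bounds the strong one; a single
    strong colouring attaining it settles both minima. *)
Lemma rvc_srvc_eq (c : V -> nat) (k : nat) :
  strongly_rainbow_vertex_connected e c -> num_colours c <= k ->
  (forall c', rainbow_vertex_connected e c' -> k <= num_colours c') ->
  [/\ strongly_connected e, rvc_eq e k & srvc_eq e k].
Proof.
have weaken c' :
    strongly_rainbow_vertex_connected e c' -> rainbow_vertex_connected e c'.
  by move=> sc u v; have [p [[dp _] rp]] := sc u v; exists p.
move=> sc lek gek; have nck : num_colours c = k.
  by apply/eqP; rewrite eqn_leq lek gek //; apply: weaken.
split.
- by move=> u v; have [p [[dp _] _]] := sc u v; exists p.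
- by split=> //; exists c => //; apply: weaken.
- by split=> [|c' /weaken]; [exists c | apply: gek].
Qed.

End Digraphs.

(** * Tournaments of diameter 2 *)

(** Relations on [nat], looked at only below [n], avoid embeddings between ordinal types when
    vertices are added. *)
Definition diameter2_tournament (n : nat) (e : rel nat) : Prop :=
  [/\ forall x, x < n -> ~~ e x x,
      forall x y, x < n -> y < n -> x != y -> e x y (+) e y x
    & forall x y, x < n -> y < n -> x != y ->
      e x y \/ exists2 z, z < n & e x z && e z y].

Definition add_two (n : nat) (e : rel nat) : rel nat := fun x y =>
  if x < n then (if y < n then e x y else y == n)
  else if x == n then y == n.+1 else y < n.

(** Missing arcs are bypassed: from old vertices to [n.+1] via [n], from [n] to old vertices via
    [n.+1], and from [n.+1] to [n] via an old vertex, for which [0] serves. *)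
Lemma diameter2_add_two (n : nat) (e : rel nat) : 0 < n ->
  diameter2_tournament n e -> diameter2_tournament n.+2 (add_two n e).
Proof.
move=> n_gt0 [irr tot diam].
have addE x : x < n.+2 -> [\/ x < n, x = n | x = n.+1].
  move=> lx; have [|[->|->]] : x < n \/ x = n \/ x = n.+1 by lia.
  - exact: Or31.
  - exact: Or32.
  - exact: Or33.
have nn : (n.+1 < n) = false by lia.
have nS : (n.+1 == n) = false by lia.
have nS' : (n == n.+1) = false by lia.
rewrite /add_two; split.
- by move=> x /addE[lx|->|->]; rewrite ?lx ?eqxx ?ltnn ?nn ?nS ?nS' ?irr ?ltnn.
- move=> x y /addE[lx|->|->] /addE[ly|->|->];
    rewrite ?eqxx // ?lx ?ly ?ltnn ?nn ?nS ?nS' ?eqxx //; by [apply: tot | lia].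
- move=> x y /addE[lx|->|->] /addE[ly|->|->] nxy;
    rewrite ?lx ?ly ?ltnn ?nn ?nS ?nS' ?eqxx;
    try by [left | rewrite eqxx in nxy].
  + have [|[z lz]] := diam x y lx ly nxy; first by left.
    by right; exists z; [lia | rewrite lz].
  + by right; exists n; [lia | rewrite ?ltnn ?eqxx].
  + by right; exists n.+1; [lia | rewrite ?nn ?nS ?eqxx].
  + by right; exists 0; [lia | rewrite ?n_gt0 ?ltnn ?nn ?nS ?eqxx].
Qed.

(** Row [x] lists the out-neighbours of [x]. Even orders start at 6 because the only strong
    tournament on 4 vertices has diameter 3. *)
Definition tournament6 : rel nat := fun x y =>
  y \in nth [::] [:: [:: 1; 2; 5]; [:: 2; 3]; [:: 3; 4; 5]; [:: 0; 4];
                     [:: 0; 1]; [:: 1; 3; 4]] x.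

Lemma diameter2_tournament6 : diameter2_tournament 6 tournament6.
Proof.
have check (P : rel nat) : all (fun x => all (P x) (iota 0 6)) (iota 0 6) ->
    forall x y, x < 6 -> y < 6 -> P x y.
  move=> /allP checkP x y lx ly.
  have /allP allPx : all (P x) (iota 0 6) by apply: checkP; rewrite mem_iota.
  by apply: allPx; rewrite mem_iota.
split.
- by move=> x lx; apply: (check (fun x _ => ~~ tournament6 x x) _ x x).
- move=> x y lx ly; apply/implyP.
  exact: (check (fun x y => (x != y) ==> tournament6 x y (+) tournament6 y x)).
- move=> x y lx ly /negPf nxy.
  have := check (fun x y => [|| x == y, tournament6 x y
    | has (fun z => tournament6 x z && tournament6 z y) (iota 0 6)])
    _ x y lx ly.
  rewrite nxy orFb => /(_ isT) /orP[|/hasP [z]]; first by left.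
  by rewrite mem_iota => lz xzy; right; exists z.
Qed.

Definition triangle : rel nat := fun x y => y == x.+1 %% 3.

Lemma diameter2_triangle : diameter2_tournament 3 triangle.
Proof.
split; [by case=> [|[|[]]]|by case=> [|[|[|?]]] [|[|[|?]]]|].
move=> x y lx ly nxy; have [|ny] := boolP (triangle x y); first by left.
right; exists (x.+1 %% 3); first by rewrite ltn_mod.
by move: x y lx ly nxy ny => [|[|[|?]]] [|[|[|?]]].
Qed.

Lemma diameter2_tournament_exists (n : nat) :
  5 <= n -> exists e, diameter2_tournament n e.
Proof.
suff odd_even d : (exists e, diameter2_tournament (3 + d.*2) e)
              /\ (exists e, diameter2_tournament (6 + d.*2) e).
  move=> hn; have [nodd|neven] := boolP (odd n).
    have [+ _] := odd_even (n - 3)./2.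
    by have <- : n = 3 + (n - 3)./2.*2 by lia.
  have [_] := odd_even (n - 6)./2.
  by have <- : n = 6 + (n - 6)./2.*2 by lia.
elim: d => [|d [[e1 He1] [e2 He2]]].
  by split; [exists triangle; apply: diameter2_triangle
            |exists tournament6; apply: diameter2_tournament6].
rewrite doubleS !addnS; split.
  by exists (add_two (3 + d.*2) e1); apply: diameter2_add_two.
by exists (add_two (6 + d.*2) e2); apply: diameter2_add_two.
Qed.

(** * Tournaments built from levels *)

Section Levels.

Variables (m k : nat).

Local Notation n := (m + k.+2).

(* By truncated subtraction, the vertices [0, ..., m] are all on level 0. *)
Definition level (x : 'I_n) : nat := x - m.

Definition level_arc : rel 'I_n := fun x y =>
  [|| level y == (level x).+1, (level y).+1 < level x | (y <= m) && (x < y)].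

(** Reduction modulo [k] is injective on levels 1 to [k]; level 0 repeats the colour of level [k],
    and level [k.+1] that of level 1. *)
Definition level_colour (x : 'I_n) : nat := level x %% k.

Lemma level_tournament : tournament level_arc.
Proof.
rewrite /level_arc /level; split=> [x|x y]; first by lia.
rewrite -val_eqE /= => nxy; lia.
Qed.

Lemma level_le (x : 'I_n) : level x <= k.+1.
Proof. by rewrite /level; have := ltn_ord x; lia. Qed.

Lemma level_surj (i : nat) : i <= k.+1 -> exists x, level x = i.
Proof.
move=> lei; have lt : m + i < n by lia.
by exists (Ordinal lt); rewrite /level /=; lia.
Qed.

Lemma level_inj (x y : 'I_n) : 0 < level x -> level x = level y -> x = y.
Proof. by rewrite /level => ? ?; apply: val_inj => /=; lia. Qed.

Lemma level_arcS (x y : 'I_n) : level_arc x y -> level y <= (level x).+1.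
Proof. by rewrite /level_arc /level; lia. Qed.

Lemma level_path (u : 'I_n) (p : seq 'I_n) :
  path level_arc u p -> level (last u p) <= level u + size p.
Proof.
elim: p u => [|x p IHp] u /=; first by rewrite addn0.
by case/andP=> /level_arcS ux /IHp; lia.
Qed.

(** Knowing the levels along the path exactly reduces distinctness of vertices and of colours to an
    interval of integers. *)
Lemma climb (u : 'I_n) (d : nat) : level u + d <= k.+1 ->
  exists2 p, path level_arc u p & map level p = iota (level u).+1 d.
Proof.
elim: d u => [|d IHd] u led; first by exists [::].
have [|x lx] := level_surj (level u).+1; first by lia.
have [|p xp lp] := IHd x; first by lia.
exists (x :: p); last by rewrite /= lp lx.
by rewrite /= xp /level_arc lx eqxx.
Qed.

Lemma uniq_map_modn (a d : nat) :
  0 < a -> a + d <= k.+1 -> uniq [seq i %% k | i <- iota a d].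
Proof.
move=> a_gt0 lead; rewrite map_inj_in_uniq ?iota_uniq // => i j.
rewrite !mem_iota => /andP[ai id] /andP[aj jd] eij.
have modk x : 0 < x -> x <= k -> x %% k = if x == k then 0 else x.
  by move=> x0 xk; case: eqP => [->|nx]; rewrite ?modnn // modn_small //; lia.
by move: eij; rewrite !modk; [do 2?case: eqP|..]; lia.
Qed.

(** An arc gains at most one level, so the climb is shortest; its internal levels lie strictly
    between those of [u] and [v], hence in 1 to [k], where colours differ. *)
Lemma level_geodesic_up (u v : 'I_n) : level u < level v ->
  exists p, geodesic level_arc u v p /\ rainbow level_colour u p.
Proof.
move=> ltuv; have lev := level_le v.
have [|p up lp] := climb u (level v - level u); first by lia.
have size_p : size p = level v - level u.
  by rewrite -(size_map level) lp size_iota.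
exists p; split; first split.
- apply/and3P; split=> //.
    rewrite -(level_inj v (last u p)) //; first by lia.
    rewrite -last_map lp; move: ltuv; rewrite -subn_gt0.
    case E: (level v - level u) => [|d] // _.
    rewrite -[d.+1]addn1 iotaD last_cat /=.
    lia.
  by apply: (@map_uniq _ _ level); rewrite /= lp; apply: (iota_uniq _ _.+1).
- move=> q /and3P[/level_path + /eqP lq _]; by rewrite lq size_p leq_subLR.
have -> : rainbow level_colour u p
    = uniq [seq i %% k | i <- behead (belast (level u) (map level p))].
  by rewrite /rainbow /internal belast_map behead_map -map_comp.
rewrite lp; case E: (level v - level u) => [|d] //=.
have -> : belast (level u).+1 (iota (level u).+2 d) = iota (level u).+1 d.
  by elim: d (level u).+1 {E} => //= d IHd a; rewrite IHd.
by apply: uniq_map_modn; lia.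
Qed.

Lemma level_strongly_rainbow : 1 < k ->
  strongly_rainbow_vertex_connected level_arc level_colour.
Proof.
move=> k_gt1 u v; have [irr _] := level_tournament.
have [ltuv|] := ltnP (level u) (level v); first exact: level_geodesic_up.
have short := geodesic_short _ level_arc level_colour u v irr.
have [uv|nuv] := eqVneq u v; first by move=> _; apply: short; apply: Or31.
have leu := level_le u; have lev := level_le v.
rewrite leq_eqVlt => /predU1P[luv|ltvu]; last first.
  (* A drop of two or more levels is an arc. A drop of one is made by climbing one level and falling
     two or, from the top level, by falling two and climbing one. *)
  apply: short; have [far|near] := ltnP (level v).+1 (level u).
    by apply: Or32; rewrite /level_arc far orbT.
  have [lek|ltk] := leqP (level u) k.
    have [|w lw] := level_surj (level u).+1; first by lia.
    by apply: Or33; exists w; rewrite /level_arc lw; lia.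
  have [|w lw] := level_surj (level v).-1; first by lia.
  by apply: Or33; exists w; rewrite /level_arc lw; lia.
have lv0 : level v = 0.
  apply/eqP; rewrite -leqn0 leqNgt; apply/negP => /level_inj/(_ luv) vu.
  by rewrite vu eqxx in nuv.
have lu0 : level u = 0 by rewrite -luv.
have [uv|nuvE] := boolP (level_arc u v); first by apply: short; apply: Or32.
(* Now [v] precedes [u] in the order on level 0; level 2 is the lowest from which an arc falls back
   to level 0. *)
have [|w1 l1] := level_surj 1 => //.
have [|w2 l2] := level_surj 2; first by lia.
exists [:: w1; w2; v]; split; first split.
- rewrite /dipath /= eqxx andbT; apply/andP; split.
    by rewrite /level_arc l1 l2 lu0 lv0.
  have neq (x y : 'I_n) : level x != level y -> x != y.
    by apply: contraNneq => ->.
  by rewrite !inE !negb_or nuv !neq // ?lu0 ?lv0 ?l1 ?l2.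
- case=> [|a [|b [|z q]]] //= /and3P[/= + /eqP].
  + by move=> _ uv; rewrite uv eqxx in nuv.
  + by rewrite andbT => + av; rewrite av (negPf nuvE).
  (* A level-0 neighbour of [u] is larger than [u], hence larger than [v]. *)
  + move=> + bv; rewrite bv; move: nuvE lu0 lv0; rewrite /level_arc /level; lia.
- rewrite /rainbow /internal /= /level_colour l1 l2.
  exact: (uniq_map_modn 1 2).
Qed.

End Levels.

Theorem theorem18 (n k : nat) (hn : 5 <= n) (hk1 : 1 <= k) (hk2 : k <= n - 2) :
  exists e : rel 'I_n,
    [/\ tournament e, strongly_connected e, rvc_eq e k & srvc_eq e k].
Proof.
move: hk1; rewrite leq_eqVlt => /predU1P[<-|k_gt1].
  have [e [irr tot diam]] := diameter2_tournament_exists n hn.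
  have n_gt0 : 0 < n by lia.
  exists (fun x y : 'I_n => e x y).
  have irrE : irreflexive (fun x y : 'I_n => e x y).
    by move=> x; apply/negbTE/irr.
  (* The constant colouring suffices in diameter 2, and a nonempty vertex set uses at least one
     colour. *)
  have [] := rvc_srvc_eq _ (fun x y : 'I_n => e x y) (fun=> 0) 1.
  - move=> u v; apply: geodesic_short => //.
    have [->|nuv] := eqVneq u v; first exact: Or31.
    have [|[z lz /andP[uz zv]]] := diam u v (ltn_ord u) (ltn_ord v) nuv.
      exact: Or32.
    by apply: Or33; exists (Ordinal lz).
  - exact: num_colours_le.
  - move=> c _; rewrite /num_colours.
    have := codom_f c (Ordinal n_gt0); rewrite -mem_undup.
    by case: (undup _).
  by move=> sc rvc srvc; split=> //; split=> // x y; apply: tot; apply: ltn_ord.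
(* One vertex for each of the [k.+2] levels leaves [m] more, all placed on level 0. *)
have [m ->] : exists m, n = m + k.+2 by exists (n - k.+2); lia.
exists (level_arc m k).
have [] := rvc_srvc_eq _ (level_arc m k) (level_colour m k) k.
- exact: level_strongly_rainbow.
- by apply: num_colours_le => x; rewrite ltn_mod; lia.
- move=> c rc; have [|u lu] := level_surj m k 0 => //.
  have [|v lv] := level_surj m k k.+1 => //.
  have [p [/and3P[up /eqP pv _] /rainbow_num_colours]] := rc u v.
  apply: leq_trans; move: (level_path _ _ u p up); rewrite pv lu lv add0n.
  by case: (size p).
by move=> sc rvc srvc; split=> //; apply: level_tournament.
Qed.
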